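(* Let $\Phi$ be a local semiflow on a complete metric space $X$ and let $K$ be a compact invariant set with a Morse decomposition $\{M_1,\dots,M_n\}$. If $$\mathrm{cat}_K(K)\neq\sum_{i=1}^n\mathrm{cat}_{M_i}(M_i),$$ then there exists a connecting trajectory $\gamma$ between $M_i$ and $M_j$ in $K$ for some $i,j\in\{1,\dots,n\}$ with $i<j$, i.e. a full solution $\gamma:\mathbb R\to K$ of $\Phi$ such that $$\omega(\gamma)\subset M_i\quad\text{and}\quad\alpha(\gamma)\subset M_j.$$
   Context: Local semiflow: a continuous map $\Phi:\mathcal D(\Phi)\to X$, with $\mathcal D(\Phi)$ open in $\mathbb R^+\times X$ ($\mathbb R^+=[0,\infty)$), such that for each $x\in X$ there is $0<T_x\leqslant\infty$ with $(t,x)\in\mathcal D(\Phi)\iff 0\leqslant t<T_x$; $\Phi(0,x)=x$; and $\Phi(t+s,x)=\Phi(t,\Phi(s,x))$ whenever $(t+s,x)\in\mathcal D(\Phi)$, $t,s\geqslant 0$. Write $\Phi(t)x=\Phi(t,x)$. A set $K$ is invariant if $\Phi(t)K=K$ for all $t\geqslant0$ (with $T_x=\infty$ for $x\in K$). A full solution (trajectory) is a map $\gamma:\mathbb R\to X$ with $\gamma(t)=\Phi(t-s)\gamma(s)$ for all $s\leqslant t$. Its limit sets are $\omega(\gamma)=\{y:\exists\, t_n\to\infty,\ \gamma(t_n)\to y\}$ and $\alpha(\gamma)=\{y:\exists\, t_n\to-\infty,\ \gamma(t_n)\to y\}$. Morse decomposition: let $K$ be a compact invariant set. A set $M$ attracts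 a set $B$ if $T_x=\infty$ for all $x\in B$ and for each neighborhood $U$ of $M$ there is $T>0$ with $\Phi(t)B\subset U$ for all $t>T$. An attractor in $K$ is a nonempty compact invariant set $A\subset K$ which attracts (for the restricted semiflow $\Phi|_K$ on $K$) some neighborhood $U$ of $A$ in $K$ and is the maximal compact invariant set in $U$; $\Omega_K(A)$ is the set of $x\in K$ attracted by $A$ under $\Phi|_K$. The empty set is also allowed as $A_0$, with $\Omega_K(\emptyset)=\emptyset$. An ordered collection $\{M_1,\dots,M_n\}$ is a Morse decomposition of $K$ if there is a sequence $\emptyset=A_0\subsetneq A_1\subsetneq\cdots\subsetneq A_n=K$ of attractors in $K$ with $M_k=A_k\setminus\Omega_K(A_{k-1})$, $1\leqslant k\leqslant n$. Category: let $Z$ be a topological space, $I=[0,1]$. A closed set $A\subset Z$ is contractible in $Z$ if there is a continuous $h:I\times A\to Z$ with $h(0,u)=u$ and $h(1,u)=h(1,v)$ for all $u,v\in A$. For closed $A\subset Z$, $\mathrm{cat}_Z(A)$ is the least $m\in\{0,1,2,\dots\}\cup\{\infty\}$ such that $A$ is a union of $m$ closed subsets of $Z$ each contractible in $Z$ ($\infty$ if no finite $m$ works; $\mathrm{cat}_Z(\emptyset)=0$). *)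

(* Defs.v *)
From HB Require Import structures.
From mathcomp Require Import all_boot all_order all_algebra.
From mathcomp Require Import all_classical all_reals all_analysis.

Set Implicit Arguments.
Unset Strict Implicit.
Unset Printing Implicit Defensive.

Import Order.TTheory GRing.Theory Num.Theory.
Import numFieldNormedType.Exports.

Local Open Scope classical_set_scope.
Local Open Scope ring_scope.

(* The library's [completeType] is a pointed type; this proposition makes sense
   for a possibly empty uniform space. *)
Definition complete_space (X : uniformType) : Prop :=
  forall F : set_system X, ProperFilter F -> cauchy F -> exists l : X, F --> l.

(* [Phi] is a total function; its values outside [sf_dom Phi] are irrelevant.
   [subspace A] carries the subspace topology on [A]. *)
Record local_semiflow (R : realType) (X : topologicalType) := LocalSemiflow {
  sf_dom : set (R * X);
  sf_map :> R * X -> X;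
  sf_time : X -> \bar R;
  sf_dom_open :
    open (sf_dom : set (subspace ([set t : R | 0 <= t] `*` [set: X])));
  sf_continuous : {within sf_dom, continuous sf_map};
  sf_time_gt0 : forall x, (0 < sf_time x)%E;
  sf_domP : forall t x, sf_dom (t, x) <-> 0 <= t /\ (t%:E < sf_time x)%E;
  sf_map0 : forall x, sf_map (0, x) = x;
  sf_mapD : forall t s x, 0 <= t -> 0 <= s -> sf_dom (t + s, x) ->
    sf_dom (t, sf_map (s, x)) /\
    sf_map (t + s, x) = sf_map (t, sf_map (s, x))
}.

Section Semiflow.
Context {R : realType} {X : topologicalType}.
Implicit Types (Phi : local_semiflow R X) (K M A B U : set X) (gamma : R -> X).

Definition sf_image Phi (t : R) B : set X := (fun x => Phi (t, x)) @` B.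

Definition invariant_set Phi K : Prop :=
  (forall x, K x -> sf_time Phi x = +oo%E) /\
  (forall t, 0 <= t -> sf_image Phi t K = K).

Definition full_solution Phi gamma : Prop :=
  forall s t, s <= t ->
    sf_dom Phi (t - s, gamma s) /\ gamma t = Phi (t - s, gamma s).

Definition omega_limit gamma : set X :=
  [set y | exists t : nat -> R,
    t n @[n --> \oo] --> +oo /\ gamma (t n) @[n --> \oo] --> y].

Definition alpha_limit gamma : set X :=
  [set y | exists t : nat -> R,
    t n @[n --> \oo] --> -oo /\ gamma (t n) @[n --> \oo] --> y].

Definition nbhd_in K M U : Prop :=
  U `<=` K /\ set_nbhs (M : set (subspace K)) U.

(* [M] attracts [B] under the semiflow restricted to the phase space [K]; the
   unrestricted notion is the case [K = setT]. *)
Definition attracts Phi K M B : Prop :=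
  (forall x, B x -> sf_time Phi x = +oo%E) /\
  (forall U, nbhd_in K M U -> exists T : R, 0 < T /\
    forall t, T < t -> sf_image Phi t B `<=` U).

Definition is_attractor Phi K A : Prop :=
  [/\ A !=set0, compact A, invariant_set Phi A, A `<=` K &
    exists U, [/\ nbhd_in K A U, attracts Phi K A U &
      forall B, compact B -> invariant_set Phi B -> B `<=` U -> B `<=` A]].

Definition basin Phi K A : set X :=
  [set x | K x /\ attracts Phi K A [set x]].

Lemma basin_set0 Phi K : basin Phi K set0 = set0.
Proof.
apply/seteqP; split=> // x [_ [_ /(_ set0)[|T [T0 /(_ (T + 1))]]]].
  by split=> // y [].
by rewrite ltrDl ltr01 => /(_ isT)/(_ (Phi (T + 1, x))); apply; exists x.
Qed.

(* The attractors [A_0, ..., A_n] are [A 0, ..., A n] (values of [A] beyond [n]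
   are irrelevant), and [M i] is the (i + 1)-st Morse set. *)
Definition morse_decomposition Phi K (n : nat) (M : 'I_n -> set X) : Prop :=
  exists A : nat -> set X,
    [/\ A 0%N = set0, A n = K,
      forall k : 'I_n, A k `<` A k.+1,
      forall k : 'I_n, is_attractor Phi K (A k.+1) &
      forall k : 'I_n, M k = A k.+1 `\` basin Phi K (A k)].

End Semiflow.

Section Category.
Context (R : realType) {X : topologicalType}.
Implicit Types Z A : set X.

(* The topological space [Z] is given as a subspace of [X]. *)
Definition contractible_in Z A : Prop :=
  exists h : R * X -> X,
    [/\ {within `[0, 1]%classic `*` A, continuous h},
      h @` (`[0, 1]%classic `*` A) `<=` Z,
      forall u, A u -> h (0, u) = u &
      forall u v, A u -> A v -> h (1, u) = h (1, v)].

Definition contractible_cover Z A (m : nat) : Prop :=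
  exists F : 'I_m -> set X,
    (forall i, [/\ F i `<=` Z, closed (F i : set (subspace Z)) &
                   contractible_in Z (F i)]) /\
    A = \bigcup_i F i.

(* Lusternik-Schnirelmann category. The infimum of a set of naturals is its
   minimum, or [+oo] when it is empty. *)
Definition ls_cat Z A : \bar R :=
  ereal_inf [set m%:R%:E | m in [set m : nat | contractible_cover Z A m]].

End Category.

(* Main.v *)
(* The full solution through a point of [K] outside the Morse sets is a
   connecting trajectory. If there is none, the Morse sets are finitely many
   disjoint closed sets with union [K], hence clopen in [K]. A nonempty set
   contractible in [K] is joined by paths in [K] to a single point, so it lies
   and contracts inside one Morse set; optimal covers of [K] therefore split
   into covers of the Morse sets, and the category is additive. *)
Require Import Defs.
From HB Require Import structures.
From mathcomp Require Import all_boot all_order all_algebra.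
From mathcomp Require Import all_classical all_reals all_analysis.
From mathcomp Require Import lra.
Import Order.TTheory GRing.Theory Num.Theory.
Import numFieldNormedType.Exports.
Local Open Scope classical_set_scope.
Local Open Scope ring_scope.

(** * Continuity along slices of a product *)

Lemma cvg_within_comp {T U : topologicalType} (f : T -> U) (D : set T)
    (E : set U) (x : T) :
  {for x, continuous f} -> (forall y, D y -> E (f y)) ->
  f @ within D (nbhs x) --> within E (nbhs (f x)).
Proof.
move=> fx DE W EW; have : nbhs x (f @^-1` [set y | E y -> W y]) by exact: fx.
by apply: filterS => y {}EW Dy; exact: EW (DE _ Dy).
Qed.

Lemma continuous_pairl {T U : topologicalType} (y : U) :
  continuous (fun x : T => (x, y)).
Proof. by move=> x; exact: (cvg_pair cvg_id (cvg_cst y)). Qed.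

Lemma continuous_pairr {T U : topologicalType} (x : T) :
  continuous (fun y : U => (x, y)).
Proof. by move=> y; exact: (cvg_pair (cvg_cst x) cvg_id). Qed.

(** * Additivity of the category over finitely many disjoint closed parts *)

Section Category.
Context {R : realType} {X : topologicalType}.
Implicit Types (Z A S : set X).

(** Allows covers indexed by dependent pairs or by a subtype of an ordinal, as needed for merging
    and splitting covers. *)
Lemma contractible_cover_fin {T : finType} {Z A} (F : T -> set X) :
  (forall i, [/\ F i `<=` Z, closed (F i : set (subspace Z)) &
                 contractible_in R Z (F i)]) ->
  A = \bigcup_i F i -> contractible_cover R Z A #|T|.
Proof.
move=> hF ->; exists (F \o enum_val); split=> [i|]; first exact: hF.
apply/seteqP; split=> x [i _ Fx]; last by exists (enum_val i).
by exists (enum_rank i) => //=; rewrite enum_rankK.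
Qed.

Lemma ls_cat_ge0 Z A : (0 <= ls_cat R Z A)%E.
Proof. by apply/le_ereal_inf_tmp => _ [m _ <-]; rewrite lee_fin. Qed.

Lemma ls_cat_le {Z A m} :
  contractible_cover R Z A m -> (ls_cat R Z A <= m%:R%:E)%E.
Proof. by move=> ZAm; apply: ereal_inf_lbound; exists m. Qed.

Lemma ls_cat_attained {Z A} : (ls_cat R Z A < +oo)%E ->
  exists2 m, contractible_cover R Z A m & ls_cat R Z A = m%:R%:E.
Proof.
move=> fin; have : exists m, `[< contractible_cover R Z A m >].
  by have [_ [m /asboolP covm _] _] := ereal_inf_lt fin; exists m.
case/ex_minnP => m /asboolP covm min_m; exists m => //.
apply/le_anti; rewrite ls_cat_le//=; apply/le_ereal_inf_tmp => _ [k covk <-].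
by rewrite lee_fin ler_nat min_m//; exact/asboolP.
Qed.

Context {n : nat} {M : 'I_n -> set X}.
Hypothesis closedM : forall i, closed (M i).
Hypothesis disjM : trivIset setT M.

(** The trace of [M i] on [S] is closed, and also open because the other parts form a finite union
    of closed sets. *)
Lemma connected_sub_part {S i} : connected S -> S `<=` \bigcup_j M j ->
  S `&` M i !=set0 -> S `<=` M i.
Proof.
move=> Sc SM SMi.
have SMiE : S `&` M i = S `&` ~` \bigcup_(j in [set j | j != i]) M j.
  apply/seteqP; split=> x [Sx Mx]; split=> //.
    move=> [j /= /eqP ji Mjx]; apply: ji.
    by apply: disjM => //; exists x.
  have [j _ Mjx] := SM _ Sx; have [<-//|ji] := eqVneq j i.
  by exfalso; apply: Mx; exists j.
have <- : S `&` M i = S; last exact: subIsetr.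
apply: Sc => //; last by exists (M i).
exists (~` \bigcup_(j in [set j | j != i]) M j) => //.
by apply/closed_openC/closed_bigcup => [|j _]; [exact: finite_finset|exact: closedM].
Qed.

(** The paths traced by the points of [A] under the contraction are connected and share the endpoint
    [h (1, u)], so all of them stay in the part containing it. *)
Lemma contractible_in_part {A} : A !=set0 ->
  contractible_in R (\bigcup_j M j) A ->
  exists2 i, A `<=` M i & contractible_in R (M i) A.
Proof.
move=> [u Au] [h [hc hM h0 h1]].
have I0 : `[0, 1]%classic (0 : R) by rewrite /= in_itv/= lexx ler01.
have I1 : `[0, 1]%classic (1 : R) by rewrite /= in_itv/= lexx ler01.
have [i _ hi] : (\bigcup_j M j) (h (1, u)) by apply: hM; exists (1, u).
have path v : A v -> (fun t => h (t, v)) @` `[0, 1]%classic `<=` M i.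
  move=> Av; apply: connected_sub_part.
  - apply: connected_continuous_connected; first exact: segment_connected.
    apply/subspace_continuousP => t t01.
    move/subspace_continuousP : hc => /(_ (t, v) (conj t01 Av)).
    apply: (@cvg_comp _ _ _ (fun s => (s, v)) h).
    by apply: (cvg_within_comp (fun s : R => (s, v)));
      [exact: continuous_pairl|].
  - by move=> _ [t t01 <-]; apply: hM; exists (t, v).
  - by exists (h (1, v)); split; [exists 1|rewrite (h1 v u)].
have AMi : A `<=` M i by move=> v Av; rewrite -(h0 v Av); apply: (path v) => //; exists 0.
exists i => //; exists h; split => // _ [[t v] [/= t01 Av] <-].
by apply: (path v) => //; exists t.
Qed.

(** The covers are pooled: since [M i] is closed, a set closed in [M i] is closed in the union, and
    a contraction in [M i] is one in the union. *)
Lemma contractible_cover_parts (m : 'I_n -> nat) :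
  (forall i, contractible_cover R (M i) (M i) (m i)) ->
  contractible_cover R (\bigcup_i M i) (\bigcup_i M i) (\sum_i m i).
Proof.
move=> covM; pose F i := projT1 (cid (covM i)).
have covF i : (forall k, [/\ F i k `<=` M i,
      closed (F i k : set (subspace (M i))) & contractible_in R (M i) (F i k)]) /\
    M i = \bigcup_k F i k := projT2 (cid (covM i)).
have -> : (\sum_i m i)%N = #|{: {i : 'I_n & 'I_(m i)}}|.
  rewrite card_tagged sumnE big_map big_enum/=.
  by apply: eq_bigr => i _; rewrite card_ord.
apply: (contractible_cover_fin (fun k => F (tag k) (tagged k))) => [[i k]/=|].
  have [/(_ k)[FM cF [h [hc hM h0 h1]]] _] := covF i.
  split; first by move=> x /FM ?; exists i.
  - apply: closed_subspaceW; have /closed_subspaceP[V cV VF] := cF.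
    by rewrite -(setIidl FM) -VF; apply: closedI.
  - by exists h; split => // x /hM ?; exists i.
apply/seteqP; split=> x [i _].
  by rewrite (covF i).2 => -[k _ Fx]; exists (Tagged (fun i => 'I_(m i)) k).
have [/(_ (tagged i))[FM _ _] _] := covF (tag i).
by move=> /FM ?; exists (tag i).
Qed.

Lemma contractible_cover_split {m} :
  contractible_cover R (\bigcup_i M i) (\bigcup_i M i) m ->
  exists2 k : 'I_n -> nat,
    forall i, contractible_cover R (M i) (M i) (k i) & (\sum_i k i <= m)%N.
Proof.
move=> [F [covF MF]].
(* Nonemptiness matters: an empty [F j] lies in every part and would be counted once for each. *)
pose P i j := `[< F j !=set0 /\ F j `<=` M i >].
exists (fun i => #|{: {j | P i j}}|) => [i|].
  apply: (contractible_cover_fin (fun j : {j | P i j} => F (val j))).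
    move=> [j /= Pij]; have /asboolP[[u Fu] FM] := Pij.
    have [_ cF ctrF] := covF j; split => //.
      have /closed_subspaceP[V cV VF] := cF.
      apply/closed_subspaceP; exists V => //.
      rewrite -[M i](_ : (\bigcup_i M i) `&` M i = _).
        by rewrite !setIA VF.
      by apply/setIidr => x ?; exists i.
    have [|i' FM' ctrF'] := contractible_in_part _ ctrF; first by exists u.
    rewrite (_ : i = i')//; apply: disjM => //.
    by exists u; split; [exact: FM|exact: FM'].
  apply/seteqP; split=> x; last by move=> [[j /= /asboolP[_]]] + _; exact.
  move=> Mix; have : (\bigcup_i M i) x by exists i.
  rewrite MF => -[j _ Fjx]; have [_ _ ctrF] := covF j.
  have [|i' FM' _] := contractible_in_part _ ctrF; first by exists x.
  have ii' : i = i' by apply: disjM => //; exists x; split => //; exact: FM'.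
  have Pij : P i j by apply/asboolP; split; [exists x|rewrite ii'].
  by exists (exist _ j Pij).
under eq_bigr do rewrite card_sig -sum1_card big_mkcond/=.
(* Double counting: by disjointness each [F j] is assigned to at most one part. *)
rewrite exchange_big/= -[leqRHS]card_ord -sum1_card; apply: leq_sum => j _.
rewrite -big_mkcond/= sum1_card; apply/card_le1_eqP => i i'.
rewrite !inE => -[[u Fu] FM] [_ FM'].
by apply: disjM => //; exists u; split; [exact: FM'|exact: FM].
Qed.

Lemma ls_cat_parts : ls_cat R (\bigcup_i M i) (\bigcup_i M i) =
  (\sum_(i < n) ls_cat R (M i) (M i))%E.
Proof.
apply/le_anti/andP; split.
  have [->|] := eqVneq (\sum_(i < n) ls_cat R (M i) (M i))%E +oo%E.
    exact: leey.
  rewrite -ltey => fin.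
  have /choice[m hm] i : exists m, contractible_cover R (M i) (M i) m /\
      ls_cat R (M i) (M i) = m%:R%:E.
    have [|m ? ?] := @ls_cat_attained (M i) (M i); last by exists m.
    (* All terms are nonnegative, so a finite sum bounds each of them. *)
    apply: le_lt_trans fin; rewrite (bigD1 i)//= leeDl// sume_ge0// => j _.
    exact: ls_cat_ge0.
  under eq_bigr do rewrite (hm _).2.
  rewrite sumEFin -natr_sum; apply: ls_cat_le.
  by apply: contractible_cover_parts => i; have [] := hm i.
apply/le_ereal_inf_tmp => _ [m /contractible_cover_split[k covk km] <-].
apply: (@le_trans _ _ (\sum_(i < n) (k i)%:R%:E)%E).
  by apply: lee_sum => i _; exact: ls_cat_le.
by rewrite sumEFin -natr_sum lee_fin ler_nat.
Qed.

End Category.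

(** * Full solutions, basins and limit sets inside an invariant set *)

Section InvariantSet.
Context {R : realType} {X : metricType R} {Phi : local_semiflow R X}.
Context {K : set X}.
Hypothesis invK : invariant_set Phi K.
Implicit Types (x y : X) (A B U : set X) (gamma : R -> X).

Lemma invariant_dom {t x} : K x -> 0 <= t -> sf_dom Phi (t, x).
Proof. by move=> Kx t0; apply/sf_domP; rewrite invK.1// ltry. Qed.

Lemma invariant_map {t x} : K x -> 0 <= t -> K (Phi (t, x)).
Proof.
move=> Kx t0; suff : sf_image Phi t K (Phi (t, x)) by rewrite invK.2.
by exists x.
Qed.

Lemma invariant_mapD {t s x} : K x -> 0 <= t -> 0 <= s ->
  Phi (t + s, x) = Phi (t, Phi (s, x)).
Proof.
move=> Kx t0 s0; have dom : sf_dom Phi (t + s, x).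
  by apply: invariant_dom => //; exact: addr_ge0.
by have [] := sf_mapD t0 s0 dom.
Qed.

Lemma invariant_map_cvg {t x} : K x -> 0 <= t ->
  Phi (t, y) @[y --> within K (nbhs x)] --> within K (nbhs (Phi (t, x))).
Proof.
move=> Kx t0.
have cvgX : Phi (t, y) @[y --> within K (nbhs x)] --> Phi (t, x).
  have /subspace_continuousP Phic := @sf_continuous _ _ Phi.
  apply: (@cvg_comp _ _ _ (fun y => (t, y)) Phi); last first.
    exact: Phic (t, x) (invariant_dom Kx t0).
  apply: (cvg_within_comp (fun y : X => (t, y))); first exact: continuous_pairr.
  by move=> y Ky; exact: invariant_dom.
move=> W /cvgX; rewrite /within/= /nbhs/=; apply: filterS => y + Ky.
by apply => //; exact: invariant_map.
Qed.

(** Since the time-one map sends [K] onto [K], choosing preimages repeatedly gives a backward orbit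
    [u] of [x]; the solution is obtained by flowing forward from [u N] placed at time [-N]. *)
Lemma full_solution_through {x} : K x -> exists gamma,
  [/\ full_solution Phi gamma, forall t, K (gamma t) & gamma 0 = x].
Proof.
move=> Kx; have /choice[g hg] y : exists z, K y -> K z /\ Phi (1, z) = y.
  have [Ky|nKy] := pselect (K y); last by exists y.
  have : sf_image Phi 1 K y by rewrite invK.2.
  by move=> [z Kz zy]; exists z.
pose u N := iter N g x.
have Ku N : K (u N) by elim: N => //= N /hg[].
have uS N : Phi (1, u N.+1) = u N by have [] := hg _ (Ku N).
(* Starting [k] time units earlier on the backward orbit gives the same value. *)
have shift N k t : 0 <= t + N%:R ->
    Phi (t + (N + k)%:R, u (N + k)%N) = Phi (t + N%:R, u N).
  move=> tN; elim: k => [|k <-]; first by rewrite addn0.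
  rewrite addnS -natr1 addrA invariant_mapD ?uS//.
  by rewrite natrD addrA addr_ge0.
(* A natural number above [|t|], so that the starting time [- c t] precedes [t]. *)
pose c (t : R) := Num.bound `|t|.
have tc t : 0 <= t + (c t)%:R.
  rewrite -lerBlDl sub0r ltW// (le_lt_trans _ (archi_boundP _))//.
  by rewrite -normrN ler_norm.
pose gamma t := Phi (t + (c t)%:R, u (c t)).
have gammaE t N : 0 <= t + N%:R -> gamma t = Phi (t + N%:R, u N).
  move=> tN; rewrite /gamma; have [le|/ltnW le] := leqP N (c t).
    by rewrite -(subnKC le) shift.
  by rewrite -[in RHS](subnKC le) shift.
have Kgamma t : K (gamma t) by exact: invariant_map.
exists gamma; split => //; last by rewrite (gammaE 0 0%N) ?addr0// sf_map0.
move=> s t st; split; first by apply: invariant_dom => //; rewrite subr_ge0.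
rewrite (gammaE t (c s)); last by rewrite (le_trans (tc s))// lerD2r.
by rewrite /gamma -invariant_mapD ?subr_ge0// addrA subrK.
Qed.

Lemma nbhd_in_open {A O} : A `<=` K -> open O -> A `<=` O ->
  nbhd_in K A (K `&` O).
Proof.
move=> AK oO AO; split=> [x []//|x Ax].
rewrite /nbhs/= -nbhs_subspace_in; last exact: AK.
apply: filterS (open_nbhs_nbhs (conj oO (AO _ Ax))) => y Oy Ky.
by split.
Qed.

(** Attraction concerns late times only: a delay of [s] just raises the threshold by [s]. *)
Lemma basin_of_map {A s x} : K x -> 0 <= s ->
  basin Phi K A (Phi (s, x)) -> basin Phi K A x.
Proof.
move=> Kx s0 [_ [_ attr]]; split => //; split=> [_ ->|U /attr[T [T0 TU]]].
  exact: invK.1.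
exists (T + s); split=> [|t Tst _ [_ -> <-]]; first exact: ltr_wpDr.
apply: (TU (t - s)); first by rewrite ltrBrDr.
exists (Phi (s, x)) => //; rewrite -invariant_mapD ?subrK//.
by rewrite subr_ge0 ltW// (lt_trans _ Tst)// ltrDr.
Qed.

Lemma attracts_sub_basin {A U} : U `<=` K -> attracts Phi K A U ->
  U `<=` basin Phi K A.
Proof.
move=> UK [fin attr] x Ux; split; first exact: UK.
split=> [_ ->|V /attr[T [T0 TV]]]; first exact: fin.
by exists T; split=> // t /TV UV _ [_ -> <-]; apply: UV; exists x.
Qed.

Lemma nbhd_in_sub {A U} : A `<=` K -> nbhd_in K A U -> A `<=` U.
Proof. by move=> AK [_ AU] x /AU; exact: nbhs_singleton. Qed.

(** Attraction is applied to the interior of [U] in [K], so that points near [x] will also be in [U]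
    at time [s]. *)
Lemma basin_enters {A U x} : nbhd_in K A U -> basin Phi K A x ->
  exists2 s, 0 <= s & within K (nbhs (Phi (s, x))) U.
Proof.
move=> [UK AU] [Kx [_ attr]].
have [|T [T0]] := attr ((U : set (subspace K))°).
  split=> [y /interior_subset/UK//|y Ay].
  by apply: nbhs_interior; exact: AU.
move=> /(_ (T + 1)); rewrite ltrDl ltr01 => /(_ isT) enters.
have T1 : 0 <= T + 1 by rewrite addr_ge0// ltW.
exists (T + 1) => //; rewrite nbhs_subspace_in; last exact: invariant_map.
by apply: enters; exists x.
Qed.

Lemma attractor_sub_basin {A} : is_attractor Phi K A -> A `<=` basin Phi K A.
Proof.
move=> [_ _ _ AK [U [AU attr _]]] x Ax.
by apply: (attracts_sub_basin AU.1 attr); exact: nbhd_in_sub AU _ Ax.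
Qed.

(** By continuity of the time-[s] map, points of [K] near [x] enter the attracted neighborhood [U]
    at the same time as [x]. *)
Lemma basin_open {A x} : is_attractor Phi K A -> basin Phi K A x ->
  within K (nbhs x) (basin Phi K A).
Proof.
move=> [_ _ _ _ [U [AU attr _]]] bx.
have [s s0 /(invariant_map_cvg bx.1 s0)] := basin_enters AU bx.
rewrite /within/= /nbhs/=; apply: filterS => y + Ky => /(_ Ky) Usy.
by apply: basin_of_map Ky s0 _; exact: attracts_sub_basin AU.1 attr _ Usy.
Qed.

Lemma cvg_within_sub {gamma} {t : nat -> R} {y} : (forall s, K (gamma s)) ->
  gamma (t n) @[n --> \oo] --> y ->
  gamma (t n) @[n --> \oo] --> within K (nbhs y).
Proof.
by move=> Kg ty W /ty; rewrite /nbhs/=; apply: filterS => n; apply; exact: Kg.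
Qed.

(** By regularity a point off [A] has a neighborhood whose closure misses [A]; the orbit eventually
    leaves that closure for good. *)
Lemma omega_limit_basin {A gamma} : closed A -> A `<=` K ->
  full_solution Phi gamma -> basin Phi K A (gamma 0) ->
  omega_limit gamma `<=` A.
Proof.
move=> cA AK full [_ [_ attr]] y [t [too ty]]; apply: contrapT => nAy.
have [W Wy WA] : exists2 W, nbhs y W & closure W `<=` ~` A.
  by apply: uniform_regular; apply: open_nbhs_nbhs; split; [exact: closed_openC|].
have [|T [T0 TW]] := attr (K `&` ~` closure W).
  apply: nbhd_in_open => //; first exact/closed_openC/closed_closure.
  by move=> a Aa /WA.
have [k [Wk Tk]] : exists k, W (gamma (t k)) /\ T < t k.
  apply: (@filter_ex _ \oo); apply: filterI; first exact: ty.
  by move/cvgryPgt : too; apply.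
have [_ /=] : (K `&` ~` closure W) (gamma (t k)).
  apply: (TW (t k)) => //; exists (gamma 0) => //.
  have [|_ ->] := full 0 (t k); first by rewrite ltW// (lt_trans T0).
  by rewrite subr0.
by apply; exact: subset_closure.
Qed.

(** A limit point in the basin would put some later point of [gamma] in it, hence [gamma 0] too.
    Openness of the basin is assumed instead of [is_attractor] so as to cover the empty set
    [A 0]. *)
Lemma omega_limit_notin_basin {A gamma} :
  (forall y, basin Phi K A y -> within K (nbhs y) (basin Phi K A)) ->
  full_solution Phi gamma -> (forall t, K (gamma t)) ->
  ~ basin Phi K A (gamma 0) -> omega_limit gamma `&` basin Phi K A = set0.
Proof.
move=> oA full Kg nb; rewrite -subset0 => y [[t [too ty]] /oA bA].
apply: nb; have [k [bk k0]] : exists k, basin Phi K A (gamma (t k)) /\ 0 <= t k.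
  apply: (@filter_ex _ \oo); apply: filterI; first exact: (cvg_within_sub Kg ty).
  by move/cvgryPge : too; apply.
apply: (basin_of_map (Kg 0) k0); have [_] := full 0 _ k0.
by rewrite subr0 => <-.
Qed.

Lemma alpha_limit_sub {A gamma} : closed A -> (forall t, A (gamma t)) ->
  alpha_limit gamma `<=` A.
Proof.
by move=> cA Ag y [t [_ ty]]; apply: (closed_cvg A cA _ _ ty); exact: nearW.
Qed.

Lemma alpha_limit_basin {A gamma y} : is_attractor Phi K A ->
  full_solution Phi gamma -> (forall t, K (gamma t)) ->
  alpha_limit gamma y -> basin Phi K A y -> forall t, A (gamma t).
Proof.
move=> [_ _ _ AK [U [AU attr _]]] full Kg [t [too ty]] bA r.
have [s s0 sU] := basin_enters AU bA.
apply: contrapT => nAr.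
have [|T [T0 TV]] := attr.2 (K `&` ~` [set gamma r]).
  apply: nbhd_in_open => //; last by move=> a Aa /= ar; rewrite -ar in nAr.
  apply: closed_openC; apply: accessible_closed_set1.
  exact/hausdorff_accessible/metric_hausdorff.
have [k [Uk tk]] : exists k, U (Phi (s, gamma (t k))) /\ t k < r - s - T.
  apply: (@filter_ex _ \oo); apply: filterI; last by move/cvgrNyPlt : too; apply.
  exact: (cvg_within_sub Kg ty _ (invariant_map_cvg bA.1 s0 _ sU)).
have Tr : T < r - t k - s by lra.
have [|_ /=] := TV _ Tr (gamma r); last by apply.
exists (Phi (s, gamma (t k))) => //; rewrite -invariant_mapD ?subrK//; last lra.
by have [|_ ->] := full (t k) r; first lra.
Qed.

End InvariantSet.

Section MorseDecomposition.
Context {R : realType} {X : metricType R} {Phi : local_semiflow R X}.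
Context {K : set X} {n : nat} {M : 'I_n -> set X} {A : nat -> set X}.
Hypothesis invK : invariant_set Phi K.
Hypothesis A0 : A 0%N = set0.
Hypothesis An : A n = K.
Hypothesis AS : forall k : 'I_n, A k `<` A k.+1.
Hypothesis attrA : forall k : 'I_n, is_attractor Phi K (A k.+1).
Hypothesis ME : forall k : 'I_n, M k = A k.+1 `\` basin Phi K (A k).

Lemma morse_attractor {k} : (0 < k <= n)%N -> is_attractor Phi K (A k).
Proof. by case: k => // k kn; exact: (attrA (Ordinal kn)). Qed.

Lemma morse_closed {k} : (k <= n)%N -> closed (A k).
Proof.
case: k => [|k] kn; first by rewrite A0; exact: closed0.
have [_ cA _ _ _] := @morse_attractor k.+1 kn.
by apply: compact_closed cA; exact: metric_hausdorff.
Qed.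

Lemma morse_sub {k} : (k <= n)%N -> A k `<=` K.
Proof.
case: k => [|k] kn; first by rewrite A0; exact: sub0set.
by have [_ _ _ AK _] := @morse_attractor k.+1 kn.
Qed.

Lemma morse_mono {k l} : (k <= l <= n)%N -> A k `<=` A l.
Proof.
elim: l => [|l IHl]; first by move=> /andP[]; rewrite leqn0 => /eqP-> _; exact: subset_refl.
case/andP; rewrite leq_eqVlt ltnS => /predU1P[-> _|kl ln].
  exact: subset_refl.
have Al : A k `<=` A l by apply: IHl; rewrite kl ltnW.
exact: subset_trans Al (properW (AS (Ordinal ln))).
Qed.

Lemma morse_basin_open {k} : (k <= n)%N -> forall y,
  basin Phi K (A k) y -> within K (nbhs y) (basin Phi K (A k)).
Proof.
case: k => [_ y|k kn y]; first by rewrite A0 basin_set0.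
by apply: basin_open => //; exact: morse_attractor.
Qed.

Lemma morse_sets_closed i : closed (M i).
Proof.
rewrite ME => x clx.
have Ax : A i.+1 x.
  by apply: (morse_closed (ltn_ord i)) => W /clx[y [[Ay _] Wy]]; exists y.
split => // /(morse_basin_open (ltnW (ltn_ord i)) x)/clx[y [[Ay nby]]].
by move=> /(_ (morse_sub (ltn_ord i) _ Ay)).
Qed.

Lemma morse_sets_disjoint : trivIset setT M.
Proof.
suff disj (i j : 'I_n) : (i < j)%N -> M i `&` M j = set0.
  move=> i j _ _ /set0P; have [/disj->|/disj|/val_inj//] := ltngtP i j.
    by rewrite eqxx.
  by rewrite setIC => ->; rewrite eqxx.
move=> ij; rewrite !ME -subset0 => x [[Ax _] [_]]; apply.
have jn := ltnW (ltn_ord j); have j0 := leq_ltn_trans (leq0n i) ij.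
apply: attractor_sub_basin; first by apply: morse_attractor; rewrite j0.
by apply: (@morse_mono i.+1 j) Ax; rewrite ij.
Qed.

(* If [p] and [q] are least such that [A p] attracts [x] and [A q] contains
   [gamma], then [omega gamma] lies in the p-th and [alpha gamma] in the q-th
   Morse set; [p = q] would put [x] itself in a Morse set. *)
Lemma morse_connection {x} : K x -> ~ (\bigcup_i M i) x ->
  exists i j : 'I_n, (i < j)%N /\
    exists gamma : R -> X,
      [/\ full_solution Phi gamma, forall t, K (gamma t),
        omega_limit gamma `<=` M i & alpha_limit gamma `<=` M j].
Proof.
move=> Kx nMx; have [g [full Kg g0]] := full_solution_through invK Kx.
have n0 : (0 < n)%N.
  by rewrite lt0n; apply/eqP => n0; move: Kx; rewrite -An n0 A0.
have [|p /andP[pn /asboolP bp] p_min] :=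
    @ex_minnP (fun k => (k <= n)%N && `[< basin Phi K (A k) x >]).
  exists n; rewrite leqnn; apply/asboolP; apply: attractor_sub_basin.
    by apply: morse_attractor; rewrite n0 leqnn.
  by rewrite An.
have [|q /andP[qn /asboolP Aq] q_min] :=
    @ex_minnP (fun k => (k <= n)%N && `[< forall t, A k (g t) >]).
  by exists n; rewrite leqnn; apply/asboolP; rewrite An.
have p0 : (0 < p)%N.
  by rewrite lt0n; apply/eqP => p0; move: bp; rewrite p0 A0 basin_set0.
have q0 : (0 < q)%N.
  by rewrite lt0n; apply/eqP => q0; have := Aq 0; rewrite q0 A0.
have pq : (p <= q)%N.
  rewrite p_min// qn; apply/asboolP; apply: attractor_sub_basin.
    by apply: morse_attractor; rewrite q0.
  by rewrite -g0; exact: Aq.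
case: p p0 pn bp p_min pq => // p _ pn bp p_min pq.
case: q q0 qn Aq q_min pq => // q _ qn Aq q_min pq.
have nbp : ~ basin Phi K (A p) x.
  by move=> /asboolP b; have := p_min p; rewrite (ltnW pn) b ltnn => /(_ isT).
exists (Ordinal pn), (Ordinal qn); split=> /=.
  rewrite ltn_neqAle -ltnS pq andbT; apply/eqP => pq_eq; apply: nMx.
  exists (Ordinal pn) => //; rewrite ME; split => //=.
  by rewrite pq_eq -g0; exact: Aq.
have omA : omega_limit g `<=` A p.+1.
  by apply: (omega_limit_basin (morse_closed pn) (morse_sub pn) full); rewrite g0.
exists g; split => // y yg; rewrite ME; split => /=.
- by apply: omA.
- move=> bpy; have := omega_limit_notin_basin invK (morse_basin_open (ltnW pn))
    full Kg; rewrite g0 => /(_ nbp); rewrite -subset0 => /(_ y); exact.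
- by apply: alpha_limit_sub yg; first exact: morse_closed.
- move=> bqy; suff Aqg : forall t, A q (g t).
    by have := q_min q; rewrite (ltnW qn) asboolT// ltnn => /(_ isT).
  apply: (alpha_limit_basin invK _ full Kg yg bqy); apply: morse_attractor.
  rewrite (ltnW qn) andbT lt0n; apply/eqP => q0.
  by move: bqy; rewrite q0 A0 basin_set0.
Qed.

End MorseDecomposition.

Theorem theorem5p1 (R : realType) (X : metricType R)
    (hX : complete_space X) (Phi : local_semiflow R X) (K : set X)
    (hKc : compact K) (hKi : invariant_set Phi K)
    (n : nat) (M : 'I_n -> set X) (hM : morse_decomposition Phi K M)
    (hcat : ls_cat R K K <> (\sum_(i < n) ls_cat R (M i) (M i))%E) :
  exists i j : 'I_n, (i < j)%N /\
    exists gamma : R -> X,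
      [/\ full_solution Phi gamma, forall t, K (gamma t),
        omega_limit gamma `<=` M i & alpha_limit gamma `<=` M j].
Proof.
have [A [A0 An AS attrA ME]] := hM.
apply: contrapT => nconn; apply: hcat.
suff -> : K = \bigcup_i M i.
  apply: ls_cat_parts; first exact: (morse_sets_closed hKi A0 attrA ME).
  exact: (morse_sets_disjoint AS attrA ME).
apply/seteqP; split=> [x Kx|x [i _]].
  apply: contrapT => nMx; apply: nconn.
  exact: (morse_connection hKi A0 An attrA ME Kx nMx).
by rewrite ME => -[/(morse_sub A0 attrA (ltn_ord i))].
Qed.
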